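(* Let $\mathcal{D}=\mathbb{R}^+\times\mathbb{R}^+$ and let $c\in[-1,+\infty)$. Then for the mean $L_c$ the two symmetries $S_{L_c}$ and $\sigma_{L_c}$ coincide, i.e. $S_{L_c}(M)=\sigma_{L_c}(M)$ for every $M\in\mathcal{M}_{\mathcal{D}}$.
   Context: A function $M\colon\mathbb{R}^+\times\mathbb{R}^+\to\mathbb{R}$ is called a mean if $\min(s,t)\le M(s,t)\le\max(s,t)$ for all $s,t\in\mathbb{R}^+$ (here $\mathbb{R}^+$ is the set of positive reals). Let $\mathcal{D}=\mathbb{R}^+\times\mathbb{R}^+$, and let $\mathcal{M}_{\mathcal{D}}$ be the set of all symmetric means $M$ on $\mathcal{D}$ (i.e. $M(s,t)=M(t,s)$) such that for all $(s,t)\in\mathcal{D}$, $M(s,t)=s$ implies $s=t$. The mean $L_c$: for $c>-1$ and $a,b>0$, $$L_c(a,b)=\frac{a+b}{2}\cdot\frac{1+2c}{2(1+c)}+\frac{1}{2(1+c)}\sqrt{\left(\frac{a+b}{2}\right)^2+4c(1+c)\left(\frac{b-a}{2}\right)^2},$$ and $L_{-1}(a,b)=\frac{2ab}{a+b}$ (the harmonic mean). Group structure: let $\mathcal{A}_{\mathcal{D}}$ be the abelian group (under pointwise addition) of functions $f\colon\mathcal{D}\to\mathbb{R}$ with $f(x,y)=-f(y,x)$. The map $\varphi\colon\mathcal{M}_{\mathcal{D}}\to\mathcal{A}_{\mathcal{D}}$ defined by $\varphi(M)(x,y)=\log\left(-\frac{M(x,y)-x}{M(x,y)-y}\right)$ for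 $x\ne y$ and $\varphi(M)(x,x)=0$ is a bijection, and $M_1\ast M_2:=\varphi^{-1}(\varphi(M_1)+\varphi(M_2))$ makes $\mathcal{M}_{\mathcal{D}}$ an abelian group. Symmetry via the group structure: for $M_0,M_1\in\mathcal{M}_{\mathcal{D}}$, $S_{M_0}(M_1)$ is the element $M_2\in\mathcal{M}_{\mathcal{D}}$ determined by $M_1\ast M_2=M_0\ast M_0$. Explicitly, for $x\neq y$ (all means evaluated at $(x,y)$), $$S_{M_0}(M_1)=\frac{x(M_1-x)(M_0-y)^2-y(M_0-x)^2(M_1-y)}{(M_1-x)(M_0-y)^2-(M_0-x)^2(M_1-y)},$$ and the value at $(x,x)$ is $x$. Functional symmetry: $\sigma_{M_0}(M_1)$ denotes the (unique) mean $M_2$ satisfying Gauss' functional equation $M_0\bigl(M_1(x,y),M_2(x,y)\bigr)=M_0(x,y)$ for all $(x,y)\in\mathcal{D}$. *)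

(* Defs.v *)
From HB Require Import structures.
From mathcomp Require Import all_boot all_order all_algebra.
From mathcomp Require Import all_classical all_reals all_analysis.
From mathcomp Require Import ring lra.

Set Implicit Arguments.
Unset Strict Implicit.
Unset Printing Implicit Defensive.

Import Order.TTheory GRing.Theory Num.Theory.

Local Open Scope ring_scope.

Record mean (R : realType) := Mean {
  mean_fun :> {posnum R} -> {posnum R} -> R;
  mean_bounds : forall s t : {posnum R},
    Num.min s%:num t%:num <= mean_fun s t <= Num.max s%:num t%:num }.

Record symmean (R : realType) := SymMean {
  symmean_mean :> mean R;
  symmean_sym : forall s t : {posnum R}, symmean_mean s t = symmean_mean t s;
  symmean_strict : forall s t : {posnum R},
    symmean_mean s t = s%:num -> s = t }.

Lemma mean_gt0 (R : realType) (M : mean R) (s t : {posnum R}) : 0 < M s t.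
Proof.
have /andP[h _] := mean_bounds M s t.
by apply: lt_le_trans h; rewrite lt_min !gt0.
Qed.

(* A mean is real-valued; this is the same value as an element of R^+, so that
   means can be composed. *)
Definition mean_pos (R : realType) (M : mean R) (s t : {posnum R}) :
  {posnum R} := PosNum (mean_gt0 M s t).

Lemma mean_ext (R : realType) (M N : mean R) :
  (forall s t, M s t = N s t) -> M = N.
Proof.
case: M N => [f hf] [g hg] /= fg.
have efg : f = g by apply/funext => s; apply/funext => t.
by subst g; congr Mean; exact: Prop_irrelevance.
Qed.

Lemma symmean_ext (R : realType) (M N : symmean R) :
  (forall s t, M s t = N s t) -> M = N.
Proof.
case: M N => [f hf kf] [g hg kg] /= fg.
have efg : f = g by exact: mean_ext.
by subst g; congr SymMean; exact: Prop_irrelevance.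
Qed.

Definition antisym_pred (R : realType) : {pred {posnum R} -> {posnum R} -> R} :=
  fun f => `[< forall x y, f x y = - f y x >].

Lemma antisym_zmod_closed (R : realType) : zmod_closed (@antisym_pred R).
Proof.
split=> [|f g /asboolP hf /asboolP hg]; apply/asboolP => x y.
  by rewrite oppr0.
by rewrite !fctE hf hg opprB opprK addrC.
Qed.

HB.instance Definition _ (R : realType) :=
  GRing.isZmodClosed.Build _ (@antisym_pred R) (@antisym_zmod_closed R).

Record antisym (R : realType) := Antisym {
  antisym_fun :> {posnum R} -> {posnum R} -> R;
  antisym_mem : antisym_fun \in @antisym_pred R }.

HB.instance Definition _ (R : realType) := [isSub for @antisym_fun R].
HB.instance Definition _ (R : realType) := [Choice of antisym R by <:].
HB.instance Definition _ (R : realType) :=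
  [SubChoice_isSubZmodule of antisym R by <:].

Lemma antisymE (R : realType) (f : antisym R) x y : f x y = - f y x.
Proof. by have /asboolP := antisym_mem f. Qed.

Section GroupStructure.
Variable R : realType.
Implicit Types (M N : symmean R) (f g : antisym R) (x y : {posnum R}).

Lemma symmean_neq M x y : x != y ->
  (M x y - x%:num != 0) /\ (M x y - y%:num != 0).
Proof.
move=> xy; rewrite !subr_eq0; split; apply: contra xy => /eqP h; apply/eqP.
  exact: symmean_strict h.
by apply/esym/(@symmean_strict _ M); rewrite symmean_sym.
Qed.

Lemma symmean_ratio_gt0 M x y : x != y ->
  0 < - ((M x y - x%:num) / (M x y - y%:num)).
Proof.
move=> xy; have [h1 h2] := symmean_neq M xy.
have := mean_bounds M x y; set m := M x y in h1 h2 *.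
rewrite -mulrN -invrN opprB.
case: (ltgtP x%:num y%:num) => [lt|lt|/val_inj /eqP]; last by rewrite (negPf xy).
  move=> /andP[a b]; apply: divr_gt0; rewrite lt_neqAle subr_ge0 ?a ?b ?andbT.
    by rewrite eq_sym.
  by rewrite eq_sym -oppr_eq0 opprB.
move=> /andP[a b]; rewrite -mulrNN -invrN !opprB; apply: divr_gt0;
  rewrite lt_neqAle subr_ge0 ?a ?b ?andbT.
  by rewrite eq_sym -oppr_eq0 opprB.
by rewrite eq_sym.
Qed.

Definition phi_fun M x y : R :=
  if x == y then 0 else ln (- ((M x y - x%:num) / (M x y - y%:num))).

Lemma phi_fun_antisym M : phi_fun M \in @antisym_pred R.
Proof.
apply/asboolP => x y; rewrite /phi_fun eq_sym.
case: eqVneq => [_|yx]; first by rewrite oppr0.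
rewrite -lnV ?qualifE/= ?symmean_ratio_gt0//.
by rewrite (symmean_sym M x y) invrN invf_div.
Qed.

Definition phi M : antisym R := Antisym (phi_fun_antisym M).

Definition phi_inv_fun f x y : R :=
  (x%:num + y%:num * expR (f x y)) / (1 + expR (f x y)).

Lemma phi_inv_bounds f x y :
  Num.min x%:num y%:num <= phi_inv_fun f x y <= Num.max x%:num y%:num.
Proof.
have e0 := expR_gt0 (f x y).
rewrite /phi_inv_fun ler_pdivlMr ?ler_pdivrMr; [|lra|lra].
by rewrite /Num.min /Num.max; case: ifP => h; apply/andP; split; nra.
Qed.

Lemma phi_inv_sym f x y : phi_inv_fun f x y = phi_inv_fun f y x.
Proof.
rewrite /phi_inv_fun (antisymE f y x) expRN.
have e0 := expR_gt0 (f x y).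
by field; apply/andP; split; lra.
Qed.

Lemma phi_inv_strict f x y : phi_inv_fun f x y = x%:num -> x = y.
Proof.
have e0 := expR_gt0 (f x y).
move=> /(congr1 (fun z => z * (1 + expR (f x y)))).
rewrite divfK; last lra.
rewrite mulrDr mulr1 => /addrI /mulIf h; apply/val_inj/esym/h; lra.
Qed.

Definition phi_inv f : symmean R :=
  @SymMean R (Mean (phi_inv_bounds f)) (phi_inv_sym f) (@phi_inv_strict f).

Lemma phiK : cancel phi phi_inv.
Proof.
move=> M; apply: symmean_ext => x y /=.
rewrite /phi_inv_fun /= /phi_fun; case: eqVneq => [<-|xy].
  have := mean_bounds M x x; rewrite minxx maxxx => /le_anti <-.
  by rewrite expR0; field.
rewrite lnK ?qualifE/= ?symmean_ratio_gt0//.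
have [h1 h2] := symmean_neq M xy.
have h3 : x%:num - y%:num != 0 by rewrite subr_eq0; exact: xy.
field; rewrite h2 /=.
by apply: contra h3 => /eqP h; apply/eqP; rewrite -[RHS]h; ring.
Qed.

Lemma phi_invK : cancel phi_inv phi.
Proof.
move=> f; apply: val_inj; apply/funext => x; apply/funext => y /=.
rewrite /phi_fun /=; case: eqVneq => [<-|xy].
  by have := antisymE f x x; lra.
rewrite -[RHS]expRK; congr ln; rewrite /phi_inv_fun.
have e0 := expR_gt0 (f x y).
have h3 : x%:num - y%:num != 0 by rewrite subr_eq0; exact: xy.
field; rewrite (_ : 1 + _ != 0) /=; last lra.
by apply: contra h3 => /eqP h; apply/eqP; rewrite -[RHS]h; ring.
Qed.

Definition mean_star M N : symmean R := phi_inv (phi M + phi N).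

Lemma mean_symmetric_exists M0 M1 :
  exists! M2, mean_star M1 M2 = mean_star M0 M0.
Proof.
exists (phi_inv (phi M0 + phi M0 - phi M1)); split.
  by rewrite /mean_star phi_invK addrC subrK.
move=> M2 /(can_inj phi_invK) <-.
by rewrite addrC addKr phiK.
Qed.

(* S_{M0}(M1), the M2 such that M1 * M2 = M0 * M0. *)
Definition mean_symmetric M0 M1 : symmean R :=
  sval (cid (mean_symmetric_exists M0 M1)).

End GroupStructure.

Definition gauss_eq (R : realType) (M0 M1 M2 : mean R) : Prop :=
  forall x y : {posnum R},
    M0 (mean_pos M1 x y) (mean_pos M2 x y) = M0 x y.

(* M2 = sigma_{M0}(M1). The map sigma_{M0} is only partially defined in
   general, hence given by its graph; uniqueness of M2 is among all means, not
   only the symmetric strict ones. *)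
Definition is_functional_symmetric (R : realType) (M0 M1 M2 : mean R) : Prop :=
  unique (gauss_eq M0 M1) M2.

Section Lc.
Variable R : realType.
Implicit Types (c : R) (a b : {posnum R}).

(* The second branch is meant for c > -1; only c >= -1 is used. *)
Definition Lc_fun c a b : R :=
  if c == -1 then 2 * a%:num * b%:num / (a%:num + b%:num) else
  (a%:num + b%:num) / 2 * ((1 + 2 * c) / (2 * (1 + c))) +
  1 / (2 * (1 + c)) *
    Num.sqrt (((a%:num + b%:num) / 2) ^+ 2
              + 4 * c * (1 + c) * ((b%:num - a%:num) / 2) ^+ 2).

Lemma Lc_sym c a b : Lc_fun c a b = Lc_fun c b a.
Proof.
rewrite /Lc_fun; case: ifP => _; first by rewrite [in RHS]addrC [in RHS](mulrAC 2).
by rewrite [b%:num + a%:num]addrC -[((a%:num - _) / 2) ^+ 2]sqrrN -mulNr opprB.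
Qed.

Lemma Lc_root c a b : -1 < c -> let L := Lc_fun c a b in
  (1 + c) * L ^+ 2 - (1 + 2 * c) * L * ((a%:num + b%:num) / 2)
  + c * (a%:num * b%:num) = 0.
Proof.
move=> hc /=; rewrite /Lc_fun gt_eqF//.
have a0 : 0 < a%:num by []; have b0 : 0 < b%:num by [].
set D := (X in Num.sqrt X).
have D0 : 0 <= D.
  suff -> : D = a%:num * b%:num + (1 + 2 * c) ^+ 2 * ((b%:num - a%:num) / 2) ^+ 2.
    by apply: addr_ge0; apply: mulr_ge0; rewrite ?sqr_ge0 ?ltW.
  by rewrite /D; field.
have := sqr_sqrtr D0; set s := Num.sqrt D => hs.
have c0 : 1 + c != 0 by rewrite gt_eqF//; lra.
transitivity ((s ^+ 2 - D) / (4 * (1 + c))); first by rewrite /D; field.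
by rewrite hs subrr mul0r.
Qed.

Lemma Lc_bounds c (hc : -1 <= c) a b :
  Num.min a%:num b%:num <= Lc_fun c a b <= Num.max a%:num b%:num.
Proof.
wlog ab : a b / a%:num <= b%:num.
  move=> h; case: (leP a%:num b%:num) => [|/ltW] ab.
    by have := h _ _ ab; rewrite (min_idPl ab) (max_idPr ab).
  by have := h _ _ ab; rewrite Lc_sym (min_idPl ab) (max_idPr ab).
rewrite (min_idPl ab) (max_idPr ab) /Lc_fun.
have a0 : 0 < a%:num by []; have b0 : 0 < b%:num by [].
move: (a%:num) (b%:num) a0 b0 ab => x y x0 y0 xy.
case: eqVneq => [_|cN].
  by rewrite ler_pdivlMr ?ler_pdivrMr ?addr_gt0//; apply/andP; split; nra.
have {}hc : 0 < 1 + c by move: hc; rewrite le_eqVlt eq_sym (negPf cN) /=; lra.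
set D := (X in Num.sqrt X).
have -> : (x + y) / 2 * ((1 + 2 * c) / (2 * (1 + c))) +
    1 / (2 * (1 + c)) * Num.sqrt D
  = ((1 + 2 * c) * ((x + y) / 2) + Num.sqrt D) / (2 * (1 + c)).
  by field; rewrite gt_eqF.
rewrite ler_pdivlMr ?ler_pdivrMr ?mulr_gt0//.
apply/andP; split.
  rewrite -lerBlDl; set u := (X in X <= _); have [u0|/ltW u0] := leP u 0.
    exact: le_trans u0 (sqrtr_ge0 _).
  rewrite -(ger0_norm u0) -sqrtr_sqr ler_wsqrtr//.
  rewrite -subr_ge0 (_ : D - _ = 2 * (1 + c) * x * (y - x)).
    apply: mulr_ge0; last by rewrite subr_ge0.
    by apply: mulr_ge0; rewrite ?ltW// mulr_gt0.
  by rewrite /u /D; field.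
rewrite -lerBrDl; set u := (X in _ <= X); have u0 : 0 <= u.
  rewrite (_ : u = (1 + c) * (y - x) + (x + y) / 2); last by rewrite /u; field.
  apply: addr_ge0; last by rewrite ltW// divr_gt0// addr_gt0.
  by apply: mulr_ge0; rewrite ?subr_ge0// ltW.
rewrite -(ger0_norm u0) -sqrtr_sqr ler_wsqrtr//.
rewrite -subr_ge0 (_ : _ - D = 2 * (1 + c) * y * (y - x)).
  apply: mulr_ge0; last by rewrite subr_ge0.
  by apply: mulr_ge0; rewrite ?ltW// mulr_gt0.
by rewrite /u /D; field.
Qed.

Lemma Lc_strict c (hc : -1 <= c) a b : Lc_fun c a b = a%:num -> a = b.
Proof.
have a0 : 0 < a%:num by []; have b0 : 0 < b%:num by [].
have [c1|c1] := eqVneq c (-1).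
  rewrite /Lc_fun c1 eqxx => /(congr1 (fun z => z * (a%:num + b%:num))).
  rewrite divfK; last by rewrite gt_eqF// addr_gt0.
  move=> h; apply/val_inj/(@mulfI _ a%:num); first by rewrite gt_eqF.
  move: h => /=; lra.
have {}hc : -1 < c by rewrite lt_neqAle eq_sym c1.
move=> h; have := Lc_root a b hc; rewrite /= h => e.
apply/val_inj/(@mulfI _ a%:num); first by rewrite gt_eqF.
move: e => /=; nra.
Qed.

Definition Lc c (hc : -1 <= c) : symmean R :=
  @SymMean R (Mean (Lc_bounds hc)) (Lc_sym c) (@Lc_strict c hc).

End Lc.

(* Main.v *)
Require Import Defs.
From mathcomp Require Import all_boot all_order all_algebra.
From mathcomp Require Import all_classical all_reals all_analysis.
From mathcomp Require Import ring lra.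

(* Write l = L_c(x, y), u = x - l, v = y - l. The quadratic equation defining l
   becomes c u v = l (u + v) / 2, i.e. 1/u + 1/v = 2c/l. On the other hand, with
   p = M(x, y) - l and q = S_{L_c}(M)(x, y) - l, the group relation
   M * S = L_c * L_c reads (p - u)(q - u) v^2 = (p - v)(q - v) u^2, i.e.
   1/p + 1/q = 1/u + 1/v. So l also solves the quadratic equation attached to
   (M(x, y), S(x, y)); as that equation has a single root between its two
   arguments, l = L_c(M(x, y), S(x, y)). Conversely, 1/p + 1/q = 2c/l determines
   q from p, whence uniqueness. *)

Set Implicit Arguments.
Unset Strict Implicit.
Unset Printing Implicit Defensive.

Import Order.TTheory GRing.Theory Num.Theory.

Local Open Scope ring_scope.

(** At c = -1 this degenerates to a linear polynomial whose root is the harmonic mean, so one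
    equation covers both branches of [Lc_fun]. *)
Definition Lc_poly (R : realType) (c a b z : R) : R :=
  (1 + c) * z ^+ 2 - (1 + 2 * c) * z * ((a + b) / 2) + c * (a * b).

Lemma Lc_poly_Lc (R : realType) (c : R) (hc : -1 <= c) (a b : {posnum R}) :
  Lc_poly c a%:num b%:num (Lc hc a b) = 0.
Proof.
have [c1|c1] := eqVneq c (-1); last first.
  by apply: Lc_root; rewrite lt_neqAle eq_sym c1.
have ab0 : a%:num + b%:num != 0 by rewrite gt_eqF.
by rewrite /Lc_poly /= /Lc_fun c1 eqxx; field.
Qed.

Lemma Lc_poly_center (R : realType) (c a b z : R) :
  Lc_poly c a b z = c * ((a - z) * (b - z)) - z * ((a - z) + (b - z)) / 2.
Proof. by rewrite /Lc_poly; field. Qed.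

Lemma Lc_poly_unique (R : realType) (c a b z w : R) :
  -1 <= c -> 0 < a -> a <= z <= b -> a <= w <= b ->
  Lc_poly c a b z = 0 -> Lc_poly c a b w = 0 -> z = w.
Proof.
move=> hc a0 /andP[az zb] /andP[aw wb] hz hw.
have [ab|ba] := ltP a b; last by apply/le_anti/andP; split; lra.
have : (z - w) * ((1 + c) * (z + w) - (1 + 2 * c) * ((a + b) / 2)) = 0.
  by rewrite -[RHS](subrr 0) -[X in _ = X - _]hz -hw /Lc_poly; ring.
move/eqP; rewrite mulf_eq0 => /orP[|/eqP h]; first by rewrite subr_eq0 => /eqP.
(* Otherwise z and w are all the roots, both >= a, although the value
   a (a - b) / 2 at a is negative. *)
have e : (1 + c) * ((z - a) * (w - a)) = a * (a - b) / 2.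
  rewrite -[LHS]addr0 -{1}hz -[LHS]addr0 -[X in _ + X](mulr0 (a - z)) -h.
  by rewrite /Lc_poly; field.
have h1 : 0 <= (1 + c) * ((z - a) * (w - a)).
  by rewrite !mulr_ge0 ?subr_ge0//; lra.
have h2 : 0 < a * (b - a) by rewrite mulr_gt0 ?subr_gt0.
lra.
Qed.

Lemma Lc_eq (R : realType) (c : R) (hc : -1 <= c) (a b : {posnum R}) (z : R) :
  Num.min a%:num b%:num <= z <= Num.max a%:num b%:num ->
  Lc_poly c a%:num b%:num z = 0 -> Lc hc a b = z.
Proof.
wlog ab : a b / a%:num <= b%:num => [H|].
  have /orP[ab|ba] := le_total a%:num b%:num; first exact: H.
  rewrite minC maxC (symmean_sym (Lc hc)) => hz h; apply: H => //.
  by rewrite -[RHS]h /Lc_poly; ring.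
move=> hz rz; have := mean_bounds (Lc hc) a b.
move: hz; rewrite (min_idPl ab) (max_idPr ab) => hz hL.
by apply: Lc_poly_unique hL hz _ rz => //; exact: Lc_poly_Lc.
Qed.

Lemma mean_diag (R : realType) (M : mean R) (x : {posnum R}) : M x x = x%:num.
Proof. by have := mean_bounds M x x; rewrite minxx maxxx => /le_anti. Qed.

(** Injectivity of [ln] turns the sum of [phi] values into a product of ratios; two ratios on each
    side make the signs cancel, and cross-multiplication removes the denominators. *)
Lemma mean_symmetric_sym_eq (R : realType) (M0 M1 : symmean R)
    (x y : {posnum R}) : x != y ->
  (M1 x y - x%:num) * (mean_symmetric M0 M1 x y - x%:num) *
    (M0 x y - y%:num) ^+ 2 =
  (M1 x y - y%:num) * (mean_symmetric M0 M1 x y - y%:num) *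
    (M0 x y - x%:num) ^+ 2.
Proof.
move=> xy; set M2 := mean_symmetric M0 M1.
have : mean_star M1 M2 = mean_star M0 M0.
  by rewrite /M2 /mean_symmetric; case: cid => N [].
move=> /(can_inj (@phi_invK R)) /(congr1 (fun f : antisym R => f x y)).
rewrite /= !fctE /= /phi_fun (negPf xy).
rewrite -!lnM ?qualifE/= ?symmean_ratio_gt0// => /ln_inj.
rewrite !qualifE/= !mulr_gt0 ?symmean_ratio_gt0// => /(_ isT isT).
have [_ h1] := symmean_neq M1 xy; have [_ h2] := symmean_neq M2 xy.
have [_ h0] := symmean_neq M0 xy.
move: h0 h1 h2; set m0 := M0 x y; set m1 := M1 x y; set m2 := M2 x y.
move=> h0 h1 h2; rewrite !mulrNN !mulf_div => /eqP.
rewrite eqr_div ?mulf_neq0// => /eqP e.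
by rewrite !expr2 e; ring.
Qed.

(** The difference of the two sides of the hypothesis is v - u times that of the conclusion.
    Reciprocals are avoided because p and q may vanish. *)
Lemma sym_eq_harmonic (R : realType) (u v p q : R) : u != v ->
  (p - u) * (q - u) * v ^+ 2 = (p - v) * (q - v) * u ^+ 2 ->
  p * q * (u + v) = (p + q) * (u * v).
Proof.
move=> uv e; apply: (@mulfI _ (v - u)); first by rewrite subr_eq0 eq_sym.
apply/eqP; rewrite -subr_eq0; apply/eqP.
transitivity ((p - u) * (q - u) * v ^+ 2 - (p - v) * (q - v) * u ^+ 2).
  by ring.
by rewrite e subrr.
Qed.

(** If p and q were both positive, 1/p > 1/v and 1/q > 0 > 1/u would contradict 1/p + 1/q = 1/u +
    1/v. If both were negative, 1/p < 1/u and 1/q < 0 < 1/v would. *)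
Lemma harmonic_mul_le0 (R : realType) (u v p q : R) : u < 0 < v ->
  u < p < v -> u < q < v ->
  p * q * (u + v) = (p + q) * (u * v) -> p * q <= 0.
Proof.
move=> /andP[u0 v0] /andP[up pv] /andP[uq qv] e.
rewrite leNgt; apply/negP => pq.
have [p0|p0] := leP p 0.
  have pN : p < 0 by rewrite lt_neqAle p0 andbT; apply: contraTneq pq => ->;
    rewrite mul0r ltxx.
  have qN : q < 0 by move: pq; rewrite nmulr_rgt0.
  have h1 : 0 < v * (q * (u - p)) by rewrite mulr_gt0// nmulr_rgt0//; lra.
  have h2 : 0 < v * (p * u) by rewrite mulr_gt0// nmulr_rgt0.
  have h3 : u * (p * q) < 0 by rewrite nmulr_rlt0.
  lra.
have q0 : 0 < q by move: pq; rewrite pmulr_rgt0.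
have h1 : u * (q * (v - p)) < 0 by rewrite nmulr_rlt0// mulr_gt0//; lra.
have h2 : u * (p * v) < 0 by rewrite nmulr_rlt0// mulr_gt0.
have h3 : 0 < v * (p * q) by rewrite mulr_gt0.
lra.
Qed.

Lemma symmean_between (R : realType) (M : symmean R) (x y : {posnum R}) :
  x%:num < y%:num -> x%:num < M x y < y%:num.
Proof.
move=> xy; have xNy : x != y by apply: contraTneq xy => ->; rewrite ltxx.
have [h1 h2] := symmean_neq M xNy; have := mean_bounds M x y.
rewrite (min_idPl (ltW xy)) (max_idPr (ltW xy)) => /andP[a b].
by rewrite !lt_neqAle a b !andbT -subr_eq0 -opprB oppr_eq0 h1 -subr_eq0 h2.
Qed.

Lemma mul_sub_le0_between (R : realType) (a b z : R) :
  (a - z) * (b - z) <= 0 -> Num.min a b <= z <= Num.max a b.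
Proof.
rewrite ge_min le_max => h; case: (ltP z a) => za /=; case: (ltP z b) => zb //=.
- by have := mulr_gt0 (_ : 0 < a - z) (_ : 0 < b - z); rewrite !subr_gt0; lra.
- by rewrite (ltW za).
- by rewrite (ltW zb) orbT.
- move: za; rewrite le_eqVlt => /predU1P[->|az]; first by rewrite lexx.
  move: zb; rewrite le_eqVlt => /predU1P[->|bz]; first by rewrite lexx orbT.
  by have := mulr_gt0 (_ : 0 < z - a) (_ : 0 < z - b); rewrite !subr_gt0; lra.
Qed.

Lemma gauss_eq_mean_symmetric (R : realType) (c : R) (hc : -1 <= c)
    (M : symmean R) : gauss_eq (Lc hc) M (mean_symmetric (Lc hc) M).
Proof.
set S := mean_symmetric _ _ => x y.
wlog : x y / x%:num < y%:num => [H|xy].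
  have [lt|lt|/val_inj <-] := ltgtP x%:num y%:num; first exact: H; last first.
    have E (N : symmean R) : mean_pos N x x = x.
      by apply/val_inj; rewrite /= mean_diag.
    by rewrite !E.
  have E (N : symmean R) : mean_pos N x y = mean_pos N y x.
    by apply/val_inj; exact: (symmean_sym N).
  by rewrite !E H//; exact: (symmean_sym (Lc hc)).
have xNy : x != y by apply: contraTneq xy => ->; rewrite ltxx.
have /andP[xl ly] := symmean_between (Lc hc) xy.
have /andP[xm my] := symmean_between M xy.
have /andP[xs sy] := symmean_between S xy.
have := mean_symmetric_sym_eq (Lc hc) M xNy; rewrite -/S.
have := Lc_poly_Lc hc x y; rewrite Lc_poly_center.
have l0 := mean_gt0 (Lc hc) x y.
set l := Lc hc x y in xl ly l0 * => hl e.
have hpq : (M x y - l) * (S x y - l) * ((x%:num - l) + (y%:num - l)) =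
  ((M x y - l) + (S x y - l)) * ((x%:num - l) * (y%:num - l)).
  apply: sym_eq_harmonic; first by rewrite (inj_eq (addIr _)).
  transitivity ((M x y - x%:num) * (S x y - x%:num) * (l - y%:num) ^+ 2).
    by ring.
  by rewrite e; ring.
apply: Lc_eq.
  (* Opposite signs of p and q place l between the values of M and S, which singles out the right
     root. *)
  apply/mul_sub_le0_between/(harmonic_mul_le0 _ _ _ hpq).
  - by apply/andP; split; lra.
  - by apply/andP; split; lra.
  - by apply/andP; split; lra.
rewrite Lc_poly_center /=.
(* After multiplication by u v, which is nonzero as x < l < y, the goal follows from p q times [hl]
   and l / 2 times [hpq]. *)
apply: (@mulfI _ ((x%:num - l) * (y%:num - l))).
  by rewrite mulf_neq0// subr_eq0 ?(lt_eqF xl) ?(gt_eqF ly).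
rewrite mulr0 -[RHS](mulr0 ((M x y - l) * (S x y - l))) -[X in _ = _ * X]hl.
apply/eqP; rewrite -subr_eq0; apply/eqP.
move: hpq; set p := M x y - l; set q := S x y - l.
set u := x%:num - l; set v := y%:num - l => hpq.
transitivity (l / 2 * (p * q * (u + v) - (p + q) * (u * v))); first by field.
by rewrite hpq subrr mulr0.
Qed.

(** For fixed l and m, the centered equation is affine in the second argument, with slope c (m - l)
    - l / 2; it remains to see that the slope is nonzero. *)
Lemma gauss_eq_Lc_inj (R : realType) (c : R) (hc : -1 <= c) (M M1 M2 : mean R) :
  gauss_eq (Lc hc) M M1 -> gauss_eq (Lc hc) M M2 -> M1 = M2.
Proof.
move=> h1 h2; apply: mean_ext => x y.
have := Lc_poly_Lc hc (mean_pos M x y) (mean_pos M1 x y).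
have := Lc_poly_Lc hc (mean_pos M x y) (mean_pos M2 x y).
rewrite h1 h2 !Lc_poly_center.
have := mean_gt0 (Lc hc) x y; move: (Lc hc x y) => l.
rewrite /=; move: (M x y) (M1 x y) (M2 x y) => m m1 m2 l0 e2 e1.
have : (c * (m - l) - l / 2) * (m1 - m2) = 0.
  by rewrite -[RHS](subrr 0) -[X in _ = X - _]e1 -e2; field.
move/eqP; rewrite mulf_eq0 => /orP[/eqP k|]; last by rewrite subr_eq0 => /eqP.
(* With slope zero only the constant term is left, which forces m = l; the slope is then - l / 2, a
   contradiction. *)
have : l * (m - l) = 0.
  transitivity (2 * ((m1 - l) * (c * (m - l) - l / 2)
    - (c * ((m - l) * (m1 - l)) - l * (m - l + (m1 - l)) / 2))); first by field.
  by rewrite k e1; ring.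
move/eqP; rewrite mulf_eq0 (gt_eqF l0) /= => /eqP ml.
by move: k; rewrite ml; lra.
Qed.

Theorem theorem7 (R : realType) (c : R) (hc : -1 <= c) (M : symmean R) :
  is_functional_symmetric (Lc hc) M (mean_symmetric (Lc hc) M).
Proof.
split; first exact: gauss_eq_mean_symmetric.
by move=> M2; apply: gauss_eq_Lc_inj; exact: gauss_eq_mean_symmetric.
Qed.
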